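(* Let $f\in S^{2d}(V^* )$ be such that the middle catalecticant $A_f:S^d(V)\to S^d(V^* )$ is nondegenerate. Suppose that a zero-dimensional subscheme $S\subset\mathbb{P}(V^* )$ of length equal to the rank of $A_f$ is apolar to $f$. Then $S$ has a nonreduced structure at a point $l\in S$ if and only if $\Omega(f)(l)=0$.
   Context: $V$ is a finite-dimensional complex vector space, $V^*$ its dual, and $\mathbb{P}(V^* )$ the projective space of lines in $V^*$, with homogeneous coordinate ring ${\rm Sym}(V)$. ${\rm Sym}(V)$ acts on ${\rm Sym}(V^* )$ by differentiation; the apolar ideal $f^\perp\subset{\rm Sym}(V)$ is the ideal of elements annihilating $f$. A subscheme $S\subset\mathbb{P}(V^* )$ with saturated homogeneous ideal $I_S\subset{\rm Sym}(V)$ is apolar to $f$ if $I_S\subset f^\perp$. The middle catalecticant of $f\in S^{2d}(V^* )$ is the linear map $A_f:S^d(V)\to S^d(V^* )$, $g\mapsto g(f)$, given by this action. If $A_f$ is an isomorphism, the anti-polar form $\Omega(f)\in S^{2d}(V)$ is the polynomial on $V^*$ defined by $\Omega(f)(x)=\langle x^d,A_f^{-1}(x^d)\rangle$ for $x\in V^*$, where $\langle\cdot,\cdot\rangle$ is the perfect pairing between $S^d(V^* )=S^d(V)^*$ and $S^d(V)$. The condition $\Omega(f)(l)=0$ for a point $l\in\mathbb{P}(V^* )$ means vanishing at any representative in $V^*$. *)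

(* Defs.v *)
From HB Require Import structures.
From mathcomp Require Import all_boot all_order all_algebra.
From mathcomp Require Import fraction.
From mathcomp Require Import ssrcomplements mpoly.
From mathcomp Require Import complex.
From mathcomp Require Import reals.

Set Implicit Arguments.
Unset Strict Implicit.
Unset Printing Implicit Defensive.

Import GRing.Theory.
Local Open Scope ring_scope.

(* A basis of V, with dim V = n, and its dual basis of V^* are fixed.  Then
   Sym(V) and Sym(V^* ) are both {mpoly K[n]}, the graded pieces S^d(V) and
   S^d(V^* ) are both dhomog n K d, and V^* is 'rV[K]_n.  An element g of
   Sym(V) is a polynomial function on V^*, with value [evalv g x] at x; an x in
   V^* is also the linear form [linform x], an element of S^1(V^* ). *)

Section Apolarity.
Variables (K : fieldType) (n : nat).
Implicit Types (g F : {mpoly K[n]}) (x : 'rV[K]_n).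

Definition evalv g x : K := g.@[fun i => x 0 i].

Definition linform x : {mpoly K[n]} := \sum_(i < n) x 0 i *: 'X_i.

(* the action of g in Sym(V) on F in Sym(V^* ) by differentiation *)
Definition diffact g F : {mpoly K[n]} :=
  \sum_(m <- msupp g) g@_m *: F^`M[m].

Definition apolar_ideal F g : Prop := diffact g F = 0.

(* The pairing S^d(V^* ) x S^d(V) -> K: when F and g are homogeneous of the same
   degree, diffact g F is a constant polynomial. *)
Definition pairing F g : K := (diffact g F)@_0%MM.

Lemma diffact_bound k g F : (msize g <= k)%N ->
  diffact g F = \sum_(m : 'X_{1..n < k}) g@_m *: F^`M[m].
Proof.
move=> le_gk; rewrite /diffact (big_mksub 'X_{1..n < k}) //=; first last.
- by move=> m /msize_mdeg_lt /leq_trans; apply.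
- exact: msupp_uniq.
rewrite big_mkcond /=; apply: eq_bigr => m _; case: ifPn => //.
by move/memN_msupp_eq0 => ->; rewrite scale0r.
Qed.

Lemma diffact_linear F : linear (diffact^~ F).
Proof.
move=> c g h; pose k := maxn (msize (c *: g + h)) (maxn (msize g) (msize h)).
rewrite !(@diffact_bound k) ?leq_max ?leqnn ?orbT //.
rewrite scaler_sumr -big_split /=; apply: eq_bigr => m _.
by rewrite mcoeffD mcoeffZ scalerDl scalerA.
Qed.

Lemma diffact_dhomog d e g F :
  g \is d.-homog -> F \is e.-homog -> diffact g F \is (e - d).-homog.
Proof.
move=> /dhomogP hg /dhomogP hF; rewrite /diffact big_seq.
apply: rpred_sum => m /hg /= <-; apply: rpredZ; apply/dhomogP => m'.
rewrite mcoeff_msupp mcoeff_mderivm => nz /=.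
have /hF /= <- : (m + m')%MM \in msupp F.
  by rewrite mcoeff_msupp; apply: contraNneq nz => ->; rewrite mul0rn.
by rewrite mdegD addKn.
Qed.

Lemma linform_dhomog x : linform x \is 1.-homog.
Proof.
by apply: rpred_sum => i _; apply: rpredZ; rewrite dhomogX /= mdeg1.
Qed.

Lemma linform_exp_dhomog d x : linform x ^+ d \is d.-homog.
Proof. by have := dhomogMn d (linform_dhomog x); rewrite mul1n. Qed.

(* x^d as an element of S^d(V^* ) *)
Definition linpow d x : dhomog n K d := DHomog (linform_exp_dhomog d x).

Section Catalecticant.
Variables (d : nat) (f : dhomog n K (2 * d)).

Lemma catalecticant_subproof (g : dhomog n K d) :
  diffact (val g) (val f) \is d.-homog.
Proof.
have := diffact_dhomog (dhomog_is_dhomog g) (dhomog_is_dhomog f).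
by rewrite (_ : (2 * d - d)%N = d) // mul2n -addnn addnK.
Qed.

Definition catalecticant_fun (g : dhomog n K d) : dhomog n K d :=
  DHomog (catalecticant_subproof g).

Lemma catalecticant_fun_linear : linear catalecticant_fun.
Proof. by move=> c g h; apply: val_inj; rewrite /= diffact_linear. Qed.

HB.instance Definition _ :=
  GRing.isLinear.Build K (dhomog n K d) (dhomog n K d) _ catalecticant_fun
    catalecticant_fun_linear.

End Catalecticant.
End Apolarity.

(* dhomog n K d is a vectType only when n is a successor. *)
Section AntiPolar.
Variables (K : fieldType) (n d : nat).
Implicit Types (f : dhomog n.+1 K (2 * d)) (x : 'rV[K]_n.+1).

(* the middle catalecticant A_f : S^d(V) -> S^d(V^* ), g |-> g(f) *)
Definition catalecticant f : 'Hom(dhomog n.+1 K d, dhomog n.+1 K d) :=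
  linfun (catalecticant_fun f).

Definition catalecticant_rank f : nat := \dim (limg (catalecticant f)).

Definition nondegenerate_catalecticant f : Prop := bijective (catalecticant f).

(* The value Omega(f)(x) = <x^d, A_f^-1 (x^d)>.  For f nondegenerate,
   (catalecticant f)^-1 is the two-sided inverse of A_f. *)
Definition antipolar f x : K :=
  pairing (val (linpow d x)) (val ((catalecticant f)^-1%VF (linpow d x))).

Lemma catalecticantE f g :
  val (catalecticant f g) = diffact (val g) (val f).
Proof. by rewrite lfunE. Qed.

Lemma catalecticantK f : nondegenerate_catalecticant f ->
  cancel (catalecticant f) (catalecticant f)^-1%VF.
Proof.
by move=> /bij_inj inj_f; apply: lker0_lfunK; apply/lker0P.
Qed.

Lemma catalecticantVK f : nondegenerate_catalecticant f ->
  cancel (catalecticant f)^-1%VF (catalecticant f).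
Proof. by move=> bij_f; apply/(bij_can_sym bij_f)/catalecticantK. Qed.

(* x |-> <x^d, A_f^-1 (x^d)> is indeed given by an element of S^(2d)(V). *)
Lemma bilinear_powers (a b : nat)
    (B : {mpoly K[n.+1]} -> {mpoly K[n.+1]} -> K) :
    (forall p, {morph B p : q q' / q + q'}) ->
    (forall p c, {morph B p : q / c *: q >-> c * q}) ->
    (forall q, {morph B^~ q : p p' / p + p'}) ->
    (forall q c, {morph B^~ q : p / c *: p >-> c * p}) ->
  exists2 W : {mpoly K[n.+1]}, W \is (a + b).-homog &
    forall x, evalv W x = B (linform x ^+ a) (linform x ^+ b).
Proof.
elim: a B => [|a IHa] B.
  elim: b B => [|b IHb] B BrD BrZ BlD BlZ.
    exists ((B 1 1)%:MP); last by move=> x; rewrite /evalv mevalC !expr0.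
    by rewrite -[_%:MP]mulr1 mul_mpolyC; apply/rpredZ/dhomog1.
  have /fin_all_exists2[W hW WE] (i : 'I_n.+1) :
      exists2 W : {mpoly K[n.+1]}, W \is (0 + b).-homog &
    forall x, evalv W x = B (linform x ^+ 0) ('X_i * linform x ^+ b).
    apply: (IHb (fun p q => B p ('X_i * q))) => [p q q'|p c q|q p p'|q c p] /=.
    - by rewrite mulrDr BrD.
    - by rewrite -scalerAr BrZ.
    - by rewrite BlD.
    - by rewrite BlZ.
  exists (\sum_i 'X_i * W i).
    apply: rpred_sum => i _; rewrite -[b.+1]add1n addnCA.
    by apply: dhomogM (hW i); rewrite dhomogX /= mdeg1.
  move=> x; have B0 p : B p 0 = 0 by rewrite -[0](scale0r 1) BrZ mul0r.
  rewrite /evalv raddf_sum /= exprS [in RHS]/linform mulr_suml.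
  rewrite (big_morph _ (BrD _) (B0 _)); apply: eq_bigr => i _.
  by rewrite mevalM mevalXU -[_.@[_]]/(evalv _ _) WE -scalerAl BrZ.
move=> BrD BrZ BlD BlZ.
have /fin_all_exists2[W hW WE] (i : 'I_n.+1) :
    exists2 W : {mpoly K[n.+1]}, W \is (a + b).-homog &
  forall x, evalv W x = B ('X_i * linform x ^+ a) (linform x ^+ b).
  apply: (IHa (fun p q => B ('X_i * p) q)) => [p q q'|p c q|q p p'|q c p] /=.
  - by rewrite BrD.
  - by rewrite BrZ.
  - by rewrite mulrDr BlD.
  - by rewrite -scalerAr BlZ.
exists (\sum_i 'X_i * W i).
  apply: rpred_sum => i _; rewrite addSn -[(a + b).+1]add1n.
  by apply: dhomogM (hW i); rewrite dhomogX /= mdeg1.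
move=> x; have B0 q : B 0 q = 0 by rewrite -[0](scale0r 1) BlZ mul0r.
rewrite /evalv raddf_sum /= exprS [in RHS]/linform mulr_suml.
rewrite (big_morph (B^~ _) (BlD _) (B0 _)); apply: eq_bigr => i _.
by rewrite mevalM mevalXU -[_.@[_]]/(evalv _ _) WE -scalerAl BlZ.
Qed.

Lemma antipolar_polynomial f :
  exists2 W : {mpoly K[n.+1]}, W \is (2 * d).-homog &
    forall x, evalv W x = antipolar f x.
Proof.
pose h (q : {mpoly K[n.+1]}) : dhomog n.+1 K d :=
  DHomog (pihomogP mdeg d q).
have hD q q' : h (q + q') = h q + h q'.
  by apply: val_inj; rewrite /= raddfD.
have hZ c q : h (c *: q) = c *: h q by apply: val_inj; rewrite /= linearZ.
pose B p q := pairing p (val ((catalecticant f)^-1%VF (h q))).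
have BrD p : {morph B p : q q' / q + q'}.
  move=> q q'; rewrite /B hD linearD /= /pairing -mcoeffD.
  have := diffact_linear p 1 (val ((catalecticant f)^-1%VF (h q))).
  by move=> /(_ (val ((catalecticant f)^-1%VF (h q')))); rewrite !scale1r => <-.
have BrZ p c : {morph B p : q / c *: q >-> c * q}.
  move=> q; rewrite /B hZ linearZ /= /pairing -mcoeffZ.
  have := diffact_linear p c (val ((catalecticant f)^-1%VF (h q))) 0.
  by rewrite /= addr0 [X in _ + X]/diffact msupp0 big_nil addr0 => <-.
have BlD q : {morph B^~ q : p p' / p + p'}.
  move=> p p'; rewrite /B /pairing -mcoeffD /diffact -big_split /=.
  by congr (_@__); apply: eq_bigr => m _; rewrite mderivmD scalerDr.
have BlZ q c : {morph B^~ q : p / c *: p >-> c * p}.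
  move=> p; rewrite /B /pairing -mcoeffZ /diffact scaler_sumr.
  congr (_@__); apply: eq_bigr => m _.
  by rewrite mderivmZ !scalerA mulrC.
have [W hW WE] := bilinear_powers d d BrD BrZ BlD BlZ.
exists W; first by rewrite mul2n -addnn.
move=> x; have hx : h (linform x ^+ d) = linpow d x.
  by apply: val_inj; rewrite /= pihomog_dE ?linform_exp_dhomog.
by rewrite WE /B hx.
Qed.

End AntiPolar.

(* K is meant to be algebraically closed: only K-rational points are used. *)
Section Schemes.
Variables (K : fieldType) (n : nat).
Implicit Types (x y : 'rV[K]_n).

(* A closed subscheme of P(V^* ), given by its saturated homogeneous ideal in
   Sym(V); the last condition says that (I : m^k) = I for every power m^k of
   the irrelevant ideal, m^k being generated by the forms of degree k. *)
Record subscheme := Subscheme {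
  ideal_of :> {mpoly K[n]} -> Prop;
  ideal0 : ideal_of 0;
  idealD : forall g h, ideal_of g -> ideal_of h -> ideal_of (g + h);
  idealM : forall a g, ideal_of g -> ideal_of (a * g);
  ideal_homog : forall g e, ideal_of g -> ideal_of (pihomog mdeg e g);
  ideal_saturated : forall g k,
    (forall a, a \is k.-homog -> ideal_of (a * g)) -> ideal_of g
}.

Implicit Types S : subscheme.

Definition apolar S (F : {mpoly K[n]}) : Prop :=
  forall g, S g -> apolar_ideal F g.

(* x represents a point of P(V^* ) which lies in S *)
Definition point_of S x : Prop := x != 0 /\ forall g, S g -> evalv g x = 0.

Definition same_point x y : Prop := exists2 c : K, c != 0 & y = c *: x.

(* The local ring of P(V^* ) at x, as a subring of the fraction field of
   Sym(V): fractions a / b with a, b forms of the same degree and b(x) != 0. *)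
Definition local_ring x (u : {fraction {mpoly K[n]}}) : Prop :=
  exists e a b, [/\ a \is e.-homog, b \is e.-homog, evalv b x != 0 &
                    u = tofrac a / tofrac b].

(* The ideal of S in it; the local ring of S at x is the quotient
   O_(S,x) = local_ring x / local_ideal S x. *)
Definition local_ideal S x (u : {fraction {mpoly K[n]}}) : Prop :=
  exists e a b, [/\ S a, a \is e.-homog, b \is e.-homog, evalv b x != 0 &
                    u = tofrac a / tofrac b].

(* dim_K O_(S,x) = k: the classes of some u_1, ..., u_k form a K-basis. *)
Definition local_length S x (k : nat) : Prop :=
  exists u : 'I_k -> {fraction {mpoly K[n]}},
  let comb (c : 'I_k -> K) := \sum_i tofrac (c i)%:MP * u i in
  [/\ forall i, local_ring x (u i),
      forall v, local_ring x v -> exists c, local_ideal S x (v - comb c) &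
      forall c, local_ideal S x (comb c) -> forall i, c i = 0].

(* the local ring O_(S,x) has a nonzero nilpotent element *)
Definition nonreduced_at S x : Prop :=
  exists u N, [/\ local_ring x u, ~ local_ideal S x u &
                  local_ideal S x (u ^+ N)].

(* p lists the points of S, each of them once *)
Definition enum_points S m (p : 'I_m -> 'rV[K]_n) : Prop :=
  [/\ forall i, point_of S (p i),
      forall i j, same_point (p i) (p j) -> i = j &
      forall x, point_of S x -> exists i, same_point (p i) x].

Definition zero_dimensional S : Prop :=
  exists m (p : 'I_m -> 'rV[K]_n), (0 < m)%N /\ enum_points S p.

(* dim_K H^0(S, O_S), as the sum of dim_K O_(S,x) over the points x of S *)
Definition has_length S (r : nat) : Prop :=
  exists m (p : 'I_m -> 'rV[K]_n) (k : 'I_m -> nat),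
  [/\ enum_points S p, forall i, local_length S (p i) (k i) &
      r = (\sum_i k i)%N].

End Schemes.

(* Main.v *)
(* Put A = A_f and let g0 = A^-1(l^d), a form of degree d on V^*, so that
   <f, g0 h> = d! h(l) for every form h of degree d; in particular
   Omega(f)(l) = d! g0(l).  Let I be the ideal of S and y a linear form vanishing
   at no point of S.  Apolarity and nondegeneracy give I_d = 0; as S has length
   dim S^d(V), every form of degree d + e is then congruent modulo I to y^e w for
   a form w of degree d.  Hence g0 h lies in I for every h of degree d with
   h(l) = 0: if g0 h = y^d w modulo I, then <f, w k> = 0 for every k of degree d,
   so w = 0.  In other words g0 / y^d spans the socle of the local ring of S at l,
   extended by zero to the other points: it is a unit of the local ring, which is
   then reduced, when g0(l) <> 0, and a nonzero nilpotent when g0(l) = 0.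

   Passing from the local rings of S to I needs the projective Nullstellensatz: a
   homogeneous ideal J maximal among those containing no power of the irrelevant
   ideal is prime, and for a coordinate x not in J and a linear form z, the forms
   x^(M-j) z^j become dependent modulo J for large M; the corresponding binary
   form splits into linear factors, so z - c x is in J for some c. *)

Require Import Defs.
From mathcomp Require Import all_boot all_order all_algebra.
From mathcomp Require Import mpoly complex reals.
From mathcomp Require Import fraction ring.
From mathcomp Require boolp classical_sets.

Set Implicit Arguments.
Unset Strict Implicit.
Unset Printing Implicit Defensive.

Import Order.TTheory GRing.Theory Num.Theory.
Local Open Scope ring_scope.

(** * Homogeneous ideals *)

Section HomogIdeal.
Variables (K : fieldType) (n : nat).
Implicit Types (J : {mpoly K[n]} -> Prop) (g h a b : {mpoly K[n]}).

(** Saturation is left out: [add_principal] need not preserve it. *)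
Record homog_ideal J : Prop := HomogIdeal {
  hid0 : J 0;
  hidD : forall g h, J g -> J h -> J (g + h);
  hidM : forall a g, J g -> J (a * g);
  hid_pihomog : forall g e, J g -> J (pihomog mdeg e g)
}.

Lemma subscheme_homog_ideal (S : subscheme K n) : homog_ideal S.
Proof.
split; [exact: ideal0 | exact: idealD | exact: idealM | exact: ideal_homog].
Qed.

Definition has_irrelevant_power J k := forall a, a \is k.-homog -> J a.

Section Closure.
Variables (J : {mpoly K[n]} -> Prop) (hJ : homog_ideal J).

Lemma hidMr a g : J g -> J (g * a).
Proof. by rewrite mulrC; apply: hidM. Qed.

Lemma hidN g : J g -> J (- g).
Proof. by rewrite -mulN1r; apply: hidM. Qed.

Lemma hidB g h : J g -> J h -> J (g - h).
Proof. by move=> Jg Jh; apply: hidD => //; apply: hidN. Qed.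

Lemma hidZ c g : J g -> J (c *: g).
Proof. by rewrite -mul_mpolyC; apply: hidM. Qed.

Lemma hidZI c g : c != 0 -> J (c *: g) -> J g.
Proof. by move=> c0 /(hidZ c^-1); rewrite scalerA mulVf // scale1r. Qed.

Lemma hid_sum (I : Type) (r : seq I) (P : pred I) (F : I -> {mpoly K[n]}) :
  (forall i, P i -> J (F i)) -> J (\sum_(i <- r | P i) F i).
Proof. by apply: big_ind; [exact: hid0 | exact: hidD]. Qed.

Lemma hid_subr g h : J (g - h) -> J g -> J h.
Proof. by move=> Jgh Jg; rewrite -(subKr g h); apply: hidB. Qed.

Lemma hid_congM g g' h h' : J (g - g') -> J (h - h') -> J (g * h - g' * h').
Proof.
move=> Jg Jh; have -> : g * h - g' * h' = h * (g - g') + g' * (h - h').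
  by rewrite !mulrBr addrA (mulrC h g') subrK (mulrC h).
by apply: (hidD hJ); apply: (hidM hJ).
Qed.

Lemma hid_congX g g' k : J (g - g') -> J (g ^+ k - g' ^+ k).
Proof.
move=> Jg; elim: k => [|k IHk]; first by rewrite subrr; apply: hid0.
by rewrite !exprS; apply: hid_congM.
Qed.

Lemma irrelevant_power_monomials k :
  (forall m : 'X_{1..n}, mdeg m = k -> J 'X_[m]) -> has_irrelevant_power J k.
Proof.
move=> Jk a /dhomogP ha; rewrite [a]mpolyE big_seq.
by apply: hid_sum => m /ha dm; apply: hidZ; apply: Jk.
Qed.

End Closure.

Lemma pihomogMl b k e g : b \is k.-homog ->
  pihomog mdeg (k + e) (b * g) = b * pihomog mdeg e g.
Proof.
move=> hb; rewrite [g](pihomog_partitionE (mf := mdeg) (leqnn _)).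
rewrite mulr_sumr !linear_sum /= mulr_sumr; apply: eq_bigr => i _.
move: (pihomog mdeg i g) (pihomogP mdeg i g) => gi hi.
have [<-|ne] := eqVneq (i : nat) e.
  by rewrite !pihomog_dE //; exact: dhomogM hb hi.
rewrite (pihomog_ne0 ne hi) mulr0 (pihomog_ne0 _ (dhomogM hb hi)) //.
by rewrite eqn_add2l.
Qed.

Lemma pihomogMl_lt b k e g : b \is k.-homog -> (e < k)%N ->
  pihomog mdeg e (b * g) = 0.
Proof.
move=> hb lt_ek; rewrite [g](pihomog_partitionE (mf := mdeg) (leqnn _)).
rewrite mulr_sumr !linear_sum /= big1 // => i _.
rewrite (pihomog_ne0 _ (dhomogM hb (pihomogP mdeg i g))) //.
by rewrite neq_ltn (leq_trans lt_ek) ?leq_addr ?orbT.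
Qed.

Lemma mnm_split (m : 'X_{1..n}) k : (k <= mdeg m)%N ->
  exists m1 m2, m = (m1 + m2)%MM /\ mdeg m1 = k.
Proof.
elim: k => [|k IHk] le_km.
  by exists 0%MM, m; rewrite add0m mdeg0.
have [m1 [m2 [def_m dm1]]] := IHk (ltnW le_km).
have /existsP[i m2i] : [exists i, m2 i != 0%N].
  apply: contraLR le_km; rewrite negb_exists => /forallP m20.
  rewrite def_m mdegD dm1 (_ : m2 = 0%MM) ?mdeg0 ?addn0 ?ltnn //.
  by apply/mnmP => i; rewrite mnm0E; apply/eqP; have := m20 i; rewrite negbK.
exists (m1 + U_(i))%MM, (m2 - U_(i))%MM; split; last first.
  by rewrite mdegD dm1 mdeg1 addn1.
rewrite def_m -addmA; congr (_ + _)%MM; rewrite addmC submK //.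
by rewrite lep1mP.
Qed.

Definition add_principal J b g := exists2 j, J j & exists u, g = j + b * u.

Lemma add_principal_homog_ideal J b k : homog_ideal J -> b \is k.-homog ->
  homog_ideal (add_principal J b).
Proof.
move=> hJ hb; split.
- by exists 0; [apply: hid0 | exists 0; rewrite mulr0 addr0].
- move=> _ _ [j Jj [u ->]] [j' Jj' [u' ->]]; exists (j + j'); first exact: hidD.
  by exists (u + u'); rewrite mulrDr addrACA.
- move=> a _ [j Jj [u ->]]; exists (a * j); first exact: hidM.
  by exists (a * u); rewrite mulrDr mulrCA.
move=> _ e [j Jj [u ->]]; exists (pihomog mdeg e j); first exact: hid_pihomog.
have [lt_ek|le_ke] := ltnP e k.
  by exists 0; rewrite mulr0 linearD /= (pihomogMl_lt _ hb lt_ek).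
exists (pihomog mdeg (e - k) u).
by rewrite linearD /= -(pihomogMl _ _ hb) subnKC.
Qed.

Lemma sub_add_principal J b g : J g -> add_principal J b g.
Proof. by exists g => //; exists 0; rewrite mulr0 addr0. Qed.

Lemma mem_add_principal J b : homog_ideal J -> add_principal J b b.
Proof.
by move=> hJ; exists 0; [apply: hid0 | exists 1; rewrite mulr1 add0r].
Qed.

Definition colon J g b := J (b * g).

Lemma colon_homog_ideal J g e : homog_ideal J -> g \is e.-homog ->
  homog_ideal (colon J g).
Proof.
move=> hJ hg; rewrite /colon; split=> [|b b' Jb Jb'|a b Jb|b k Jb].
- by rewrite mul0r; apply: hid0.
- by rewrite mulrDl; apply: hidD.
- by rewrite -mulrA; apply: hidM.
by rewrite mulrC -(pihomogMl _ _ hg); apply: hid_pihomog => //; rewrite mulrC.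
Qed.

End HomogIdeal.

(** * Homogeneous ideals maximal among those containing no power of the irrelevant ideal *)

Section MaximalIdeal.
Variables (K : fieldType) (n : nat).
Implicit Types (J : {mpoly K[n]} -> Prop) (g h a b : {mpoly K[n]}).

Definition irrelevant_free J := forall k, ~ has_irrelevant_power J k.

(** Zorn's lemma applies because each power of the irrelevant ideal is generated by finitely many
    monomials: if the union of a chain contains them all, so does a single member. *)
Lemma exists_maximal_irrelevant_free I : homog_ideal I -> irrelevant_free I ->
  exists J, [/\ homog_ideal J, irrelevant_free J, forall g, I g -> J g &
    forall J', homog_ideal J' -> irrelevant_free J' ->
      (forall g, J g -> J' g) -> forall g, J' g -> J g].
Proof.
move=> hI fI.
(* [P] must hold of the empty set, the union of the empty chain: hence [J 0] is
   not required, and [I] is included in [J] only when [J] is nonempty. *)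
pose P J := [/\ forall g h, J g -> J h -> J (g + h),
  forall a g, J g -> J (a * g), forall g e, J g -> J (pihomog mdeg e g),
  forall g, J g -> forall i, I i -> J i & irrelevant_free J].
have PI J' : homog_ideal J' -> irrelevant_free J' -> (forall i, I i -> J' i) ->
    P J'.
  by move=> [J0 JD JM JH] fJ IJ; split=> // *; apply: IJ.
have [F FP Ftot|J [[JD JM JH JI fJ] Jmax]] := @classical_sets.Zorn_bigcup _ P.
  have mono g h X Y : F X -> F Y -> X g -> Y h ->
      exists Z, [/\ F Z, Z g & Z h].
    move=> FX FY Xg Yh; case: (Ftot X Y FX FY) => XY.
      by exists Y; split=> //; apply: XY.
    by exists X; split=> //; apply: XY.
  split.
  - move=> g h [X FX Xg] [Y FY Yh].
    have [Z [FZ Zg Zh]] := mono _ _ _ _ FX FY Xg Yh.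
    by exists Z => //; have [ZD _ _ _ _] := FP Z FZ; apply: ZD.
  - move=> a g [X FX Xg]; exists X => //; have [_ XM _ _ _] := FP X FX.
    exact: XM.
  - move=> g e [X FX Xg]; exists X => //; have [_ _ XH _ _] := FP X FX.
    exact: XH.
  - move=> g [X FX Xg] i Ii; exists X => //; have [_ _ _ XI _] := FP X FX.
    exact: XI Xg _ Ii.
  move=> k hk.
  have [X0 FX0 X00] : classical_sets.bigcup F id (0 : {mpoly K[n]}).
    by apply: hk; apply: dhomog0.
  have Fk (s : seq 'X_{1..n}) : exists X, [/\ F X, X 0 &
      forall m, m \in s -> mdeg m = k -> X 'X_[m]].
    elim: s => [|m s [X [FX X0' Xs]]]; first by exists X0.
    have [dm|ndm] := eqVneq (mdeg m) k; last first.
      exists X; split=> // m'; rewrite inE => /orP[/eqP ->|/Xs //].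
      by move/eqP; rewrite (negPf ndm).
    have [Y FY Ym] : classical_sets.bigcup F id ('X_[m] : {mpoly K[n]}).
      by apply: hk; rewrite dhomogX /= dm.
    case: (Ftot X Y FX FY) => XY.
      exists Y; split=> // [|m']; first exact: XY.
      by rewrite inE => /orP[/eqP -> //|m's dm']; apply: XY; apply: Xs.
    exists X; split=> // m'; rewrite inE => /orP[/eqP -> _|]; first exact: XY.
    exact: Xs.
  have [X [FX X0' Xk]] := Fk [seq val m | m : 'X_{1..n < k.+1}].
  have [XD XM XH XI fX] := FP X FX.
  apply: (fX k); apply: irrelevant_power_monomials => // m dm; apply: Xk => //.
  have lt_m : (mdeg m < k.+1)%N by rewrite dm.
  by apply/mapP; exists (BMultinom lt_m); rewrite ?mem_enum.
(* An empty [J] would be strictly contained in [I], against its maximality. *)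
have [[j0 Jj0]|nJ] := boolp.pselect (exists j, J j); last first.
  case: (Jmax I); last by case: hI => *; split.
  split=> [g Jg|]; first by case: nJ; exists g.
  by move=> IJ; apply: nJ; exists 0; apply: IJ; apply: hid0.
have J0 : J 0 by rewrite -[0](mul0r j0); apply: JM.
exists J; split=> // [|J' hJ' fJ' JJ' g J'g]; first exact: JI J0.
apply: boolp.contrapT => nJg; apply: (Jmax J'); last first.
  by apply: PI => // i Ii; apply: JJ'; apply: (JI _ J0).
by split=> // JJ; apply: nJg; apply: JJ.
Qed.

Variable J : {mpoly K[n]} -> Prop.
Hypotheses (hJ : homog_ideal J) (fJ : irrelevant_free J).
Hypothesis Jmax : forall J', homog_ideal J' -> irrelevant_free J' ->
  (forall g, J g -> J' g) -> forall g, J' g -> J g.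

Lemma maximal_add_power b k : b \is k.-homog -> ~ J b ->
  exists e, has_irrelevant_power (add_principal J b) e.
Proof.
move=> hb nJb; apply: boolp.contrapT => nex; apply: nJb.
apply: (Jmax (add_principal_homog_ideal hJ hb)).
- by move=> e he; apply: nex; exists e.
- by move=> g; apply: sub_add_principal.
exact: mem_add_principal.
Qed.

(** If neither factor is in [J], then by maximality J + (b) contains m^s and J + (c) contains m^t.
    The product of these two ideals lies in J + (bc) = J, so [J] would contain m^(s+t). *)
Lemma maximal_prime b c k e : b \is k.-homog -> c \is e.-homog -> J (b * c) ->
  J b \/ J c.
Proof.
move=> hb hc Jbc; have [|nJb] := boolp.pselect (J b); first by left.
have [|nJc] := boolp.pselect (J c); first by right.
have [s hs] := maximal_add_power hb nJb.
have [t ht] := maximal_add_power hc nJc.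
case: (fJ (k := (s + t)%N)); apply: irrelevant_power_monomials => // m dm.
have [|m1 [m2 [def_m dm1]]] := @mnm_split _ m s; first by rewrite dm leq_addr.
have dm2 : mdeg m2 = t by move: dm; rewrite def_m mdegD dm1 => /addnI.
have [j Jj [u def_u]] : add_principal J b 'X_[m1].
  by apply: hs; rewrite dhomogX /= dm1.
have [j' Jj' [u' def_u']] : add_principal J c 'X_[m2].
  by apply: ht; rewrite dhomogX /= dm2.
rewrite def_m mpolyXD def_u def_u' mulrDl; apply: (hidD hJ).
  exact: hidMr.
rewrite mulrDr; apply: (hidD hJ); first exact: hidM.
by rewrite mulrACA; apply: hidMr.
Qed.

Lemma maximal_not1 : ~ J 1.
Proof.
by move=> J1; apply: (fJ (k := 0)) => a _; rewrite -[a]mulr1; apply: hidM.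
Qed.

Lemma maximal_primeX b k m : b \is k.-homog -> J (b ^+ m) -> J b.
Proof.
move=> hb; elim: m => [/maximal_not1 //|m IHm].
by rewrite exprS => /(maximal_prime hb (dhomogMn m hb)) [].
Qed.

Lemma maximal_coord : exists i, ~ J 'X_i.
Proof.
apply: boolp.contrapT => nex; apply: (fJ (k := 1)).
apply: irrelevant_power_monomials => // m /eqP /mdeg1P[i /eqP ->].
by apply: boolp.contrapT => nJi; apply: nex; exists i.
Qed.

End MaximalIdeal.

(** * The projective Nullstellensatz *)

Lemma exists_dependency (K : fieldType) (T : finType) k (A : 'I_k -> T -> K) :
  (#|T| < k)%N ->
  exists2 c : 'I_k -> K, (exists i, c i != 0) & forall t, \sum_i c i * A i t = 0.
Proof.
move=> lt_Tk; pose M := \matrix_(i < k, j < #|T|) A i (enum_val j).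
have /rowV0Pn[v /sub_kermxP vM v0] : kermx M != 0.
  rewrite -mxrank_eq0 mxrank_ker -lt0n subn_gt0.
  by rewrite (leq_ltn_trans (rank_leq_col M)).
exists (v 0) => [|t].
  by have /rV0Pn := v0.
have /matrixP/(_ 0 (enum_rank t)) := vM; rewrite !mxE => vMt.
by rewrite -[RHS]vMt; apply: eq_bigr => i _; rewrite !mxE enum_rankK.
Qed.

Section Homogenize.
Variables (K : closedFieldType) (n : nat) (x y : {mpoly K[n]}).
Implicit Types (p q : {poly K}) (M : nat).
Hypotheses (hx : x \is 1.-homog) (hy : y \is 1.-homog).

(** For [p] of degree at most [M], this is the binary form x^M p(y/x). *)
Definition homogenize M (p : {poly K}) : {mpoly K[n]} :=
  \sum_(j < M.+1) p`_j *: (x ^+ (M - j) * y ^+ j).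

Lemma homogenize_dhomog M p : homogenize M p \is M.-homog.
Proof.
apply: rpred_sum => j _; apply: rpredZ.
suff: x ^+ (M - j) * y ^+ j \is (M - j + j).-homog by rewrite subnK ?leq_ord.
apply: dhomogM.
  by have := dhomogMn (M - j) hx; rewrite mul1n.
by have := dhomogMn j hy; rewrite mul1n.
Qed.

Lemma homogenizeB M p q : homogenize M (p - q) = homogenize M p - homogenize M q.
Proof.
by rewrite -sumrB; apply: eq_bigr => j _; rewrite coefB scalerBl.
Qed.

Lemma homogenizeS M p : (size p <= M.+1)%N ->
  homogenize M.+1 p = x * homogenize M p.
Proof.
move=> /leq_sizeP sp; rewrite /homogenize big_ord_recr /= sp // scale0r addr0.
rewrite mulr_sumr; apply: eq_bigr => j _.
by rewrite subSn ?leq_ord // exprS -mulrA scalerAr.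
Qed.

Lemma homogenizeMX M p : homogenize M.+1 (p * 'X) = y * homogenize M p.
Proof.
rewrite /homogenize big_ord_recl coefMX /= scale0r add0r mulr_sumr.
apply: eq_bigr => j _; rewrite coefMX /= subSS exprS mulrCA.
by rewrite scalerAr.
Qed.

Lemma homogenizeMC M p c : homogenize M (p * c%:P) = c *: homogenize M p.
Proof.
rewrite scaler_sumr; apply: eq_bigr => j _.
by rewrite coefMC mulrC scalerA.
Qed.

Lemma homogenizeMXsubC M p c : (size p <= M.+1)%N ->
  homogenize M.+1 (p * ('X - c%:P)) = (y - c *: x) * homogenize M p.
Proof.
move=> sp; rewrite mulrBr homogenizeB homogenizeMX homogenizeMC.
by rewrite homogenizeS // mulrBl scalerAl.
Qed.

Variable J : {mpoly K[n]} -> Prop.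
Hypotheses (hJ : homog_ideal J) (nJ1 : ~ J 1) (nJx : ~ J x).
Hypothesis Jprime : forall b c k e, b \is k.-homog -> c \is e.-homog ->
  J (b * c) -> J b \/ J c.

(** Induction on [M]: a factor [x] splits off when deg p < M, and otherwise a root [c] of [p] gives
    a factor y - c x. Primality puts y - c x or the cofactor in [J], since [x] is not there. For M =
    0 the form is a nonzero constant, which [nJ1] excludes. *)
Lemma prime_linear_factor M p : p != 0 -> (size p <= M.+1)%N ->
  J (homogenize M p) -> exists c, J (y - c *: x).
Proof.
elim: M p => [|M IHM] p p0 sp Jp.
  case: nJ1; apply: (@hidZI _ _ J hJ p`_0).
    by apply: contraNneq p0 => p00; rewrite (size1_polyC sp) p00.
  by move: Jp; rewrite /homogenize big_ord1 mulr1.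
have [sp'|lt_sp] := leqP (size p) M.+1.
  move: Jp; rewrite homogenizeS // => /(Jprime hx (homogenize_dhomog M p)) [//|].
  exact: IHM.
have /closed_rootP[c /factor_theorem[q def_p]] : size p != 1%N.
  by rewrite neq_ltn (leq_trans _ lt_sp) ?orbT.
have q0 : q != 0 by apply: contraNneq p0 => q0; rewrite def_p q0 mul0r.
have sq : (size q <= M.+1)%N.
  by move: sp; rewrite def_p size_Mmonic ?monicXsubC // size_XsubC addn2.
move: Jp; rewrite def_p homogenizeMXsubC // => Jp.
have hyx : y - c *: x \is 1.-homog by apply: rpredB => //; apply: rpredZ.
case: (Jprime hyx (homogenize_dhomog M q) Jp) => [|Jq]; first by exists c.
exact: IHM Jq.
Qed.

End Homogenize.


Section Nullstellensatz.
Variables (K : closedFieldType) (n : nat).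
Implicit Types (J : {mpoly K[n]} -> Prop) (g x y : {mpoly K[n]}).

Lemma irrelevant_power_leq J k e : homog_ideal J -> (k <= e)%N ->
  has_irrelevant_power J k -> has_irrelevant_power J e.
Proof.
move=> hJ le_ke hk; apply: irrelevant_power_monomials => // m dm.
have [|m1 [m2 [-> dm1]]] := @mnm_split _ m k; first by rewrite dm.
by rewrite mpolyXD; apply: hidMr => //; apply: hk; rewrite dhomogX /= dm1.
Qed.

(** Modulo [J], every form of degree at least [k] is a multiple of [x], so a factor [x] can be taken
    out until degree [k] is reached. *)
Lemma add_principal_expX J x k e g : homog_ideal J -> x \is 1.-homog ->
  has_irrelevant_power (add_principal J x) k -> g \is (e + k).-homog ->
  exists2 r, r \is k.-homog & J (g - x ^+ e * r).
Proof.
move=> hJ hx hk; elim: e g => [|e IHe] g hg.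
  by exists g => //; rewrite mul1r subrr; apply: hid0.
have [j Jj [u def_g]] : add_principal J x g.
  apply: irrelevant_power_leq hk _ hg; last exact: leq_addl.
  exact: add_principal_homog_ideal hx.
(* The cofactor [u] need not be homogeneous; only its component of degree e + k contributes to
   [g]. *)
have [r hr Jr] := IHe _ (pihomogP mdeg (e + k) u).
exists r => //; rewrite -(pihomog_dE hg) def_g linearD /= addSn -add1n.
rewrite (pihomogMl _ _ hx) -addrA exprS -mulrA -mulrBr.
by apply: hidD => //; [apply: hid_pihomog | apply: hidM].
Qed.

Lemma bounded_relation J x y k : homog_ideal J ->
  x \is 1.-homog -> y \is 1.-homog ->
  has_irrelevant_power (add_principal J x) k ->
  exists M (p : {poly K}), [/\ p != 0, (size p <= M.+1)%N &
    J (homogenize x y M p)].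
Proof.
move=> hJ hx hy hk; pose T : finType := 'X_{1..n < k.+1}.
(* M >= k allows x^(M-k) to be taken out of each of the M + 1 forms [g j]. The remaining factors
   have degree [k], and M >= #|T| makes them more numerous than the monomials available, hence
   dependent. *)
pose M := maxn k #|T|; pose g (j : 'I_M.+1) := x ^+ (M - j) * y ^+ j.
have /fin_all_exists2[r hr Jr] (j : 'I_M.+1) :
    exists2 r, r \is k.-homog & J (g j - x ^+ (M - k) * r).
  apply: add_principal_expX hk _ => //; rewrite subnK ?leq_maxl //.
  suff: g j \is (M - j + j).-homog by rewrite subnK ?leq_ord.
  by apply: dhomogM; [have := dhomogMn (M - j) hx | have := dhomogMn j hy];
     rewrite mul1n.
have [|c [i ci] rel] := @exists_dependency K T M.+1 (fun j m => (r j)@_m).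
  by rewrite ltnS leq_maxr.
exists M, (\poly_(j < M.+1) c (inord j)); split; last 1 first.
- have -> : homogenize x y M (\poly_(j < M.+1) c (inord j)) =
      \sum_j c j *: (g j - x ^+ (M - k) * r j).
    transitivity (\sum_j c j *: g j).
      by apply: eq_bigr => j _; rewrite coef_poly ltn_ord inord_val.
    apply/eqP; rewrite -subr_eq0 -sumrB; apply/eqP.
    transitivity (x ^+ (M - k) * \sum_j c j *: r j).
      rewrite mulr_sumr; apply: eq_bigr => j _.
      by rewrite -scalerBr subKr scalerAr.
    suff -> : \sum_j c j *: r j = 0 by rewrite mulr0.
    apply/mpolyP => m; rewrite mcoeff0 raddf_sum /=.
    have [dm|ndm] := eqVneq (mdeg m) k.
      have lt_m : (mdeg m < k.+1)%N by rewrite dm.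
      rewrite -[RHS](rel (BMultinom lt_m)); apply: eq_bigr => j _.
      by rewrite mcoeffZ.
    by apply: big1 => j _; rewrite mcoeffZ (dhomog_nemf_coeff (hr j) ndm) mulr0.
  by apply: hid_sum => // j _; apply: hidZ.
- apply: contraNneq ci => p0; have := congr1 (fun p : {poly K} => p`_i) p0.
  by rewrite coef_poly ltn_ord inord_val coef0 => ->.
exact: size_poly.
Qed.

Lemma projective_nullstellensatz (I : {mpoly K[n]} -> Prop) :
  homog_ideal I -> irrelevant_free I ->
  exists x : 'rV[K]_n, x != 0 /\ forall g, I g -> evalv g x = 0.
Proof.
move=> hI fI.
have [J [hJ fJ IJ Jmax]] := exists_maximal_irrelevant_free hI fI.
have [s nJs] := maximal_coord hJ fJ.
have Jprime := maximal_prime hJ fJ Jmax.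
have hX i : ('X_i : {mpoly K[n]}) \is 1.-homog by rewrite dhomogX /= mdeg1.
have [k hk] := maximal_add_power hJ Jmax (hX s) nJs.
have /fin_all_exists[c Jc] (i : 'I_n) : exists c, J ('X_i - c *: 'X_s).
  have [M [p [p0 sp Jp]]] := bounded_relation hJ (hX s) (hX i) hk.
  have nJ1 := maximal_not1 hJ fJ.
  exact: (prime_linear_factor (hX s) (hX i) hJ nJ1 nJs Jprime p0 sp Jp).
(* The coordinate [c s] is nonzero, since otherwise [Jc s] would put 'X_s in [J]. *)
exists (\row_i c i); split.
  apply/eqP => /rowP/(_ s); rewrite !mxE => cs; apply: nJs.
  by have := Jc s; rewrite cs scale0r subr0.
(* Substituting c_i X_s for each X_i shows that a form of degree [e] is its value at [c] times X_s^e
   modulo [J]. As X_s^e is not in [J], forms in [J] vanish at [c]. *)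
have Jhom g e : g \is e.-homog -> J (g - evalv g (\row_i c i) *: 'X_s ^+ e).
  move=> hg; rewrite /evalv {1}[g]mpolyE mevalE scaler_suml -sumrB big_seq.
  apply: hid_sum => // m /(dhomog_mf hg) /= dm.
  rewrite -scalerA -scalerBr; apply: hidZ => //.
  have -> : (\prod_i (\row_i c i) 0 i ^+ m i) *: 'X_s ^+ e =
      \prod_i (c i *: 'X_s : {mpoly K[n]}) ^+ m i.
    rewrite (eq_bigr _ (fun i _ => exprZn _ _ _)) scaler_prod prodrXr -mdegE dm.
    by congr (_ *: _); apply: eq_bigr => i _; rewrite mxE.
  rewrite mpolyXE_id.
  elim/big_ind2: _ => [|? ? ? ?|i _]; first by rewrite subrr; apply: hid0.
  - exact: hid_congM.
  by apply: hid_congX.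
move=> g /IJ Jg.
rewrite [g](pihomog_partitionE (mf := mdeg) (leqnn _)) /evalv linear_sum.
apply: big1 => e _; set h := pihomog _ _ _.
have hh : h \is e.-homog by apply: pihomogP.
have Jh : J h by apply: hid_pihomog.
apply/eqP; apply: contra_notT nJs => h0.
apply: (maximal_primeX hJ fJ Jmax (hX s) (m := e)).
by apply: hidZI h0 _ => //; apply: hid_subr (Jhom _ _ hh) Jh.
Qed.

End Nullstellensatz.

(** * Local and global ideals of a zero-dimensional scheme *)

Section Evaluation.
Variables (K : fieldType) (n : nat).
Implicit Types (g h b : {mpoly K[n]}) (x : 'rV[K]_n).

Lemma evalvM g h x : evalv (g * h) x = evalv g x * evalv h x.
Proof. exact: mevalM. Qed.

Lemma evalvX g k x : evalv (g ^+ k) x = evalv g x ^+ k.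
Proof. exact: rmorphXn. Qed.

Lemma evalvB g h x : evalv (g - h) x = evalv g x - evalv h x.
Proof. exact: mevalB. Qed.

Lemma evalv_neq0 g x : evalv g x != 0 -> g != 0.
Proof. by apply: contraNneq => ->; rewrite /evalv meval0. Qed.

Lemma evalv_scale g e c x : g \is e.-homog ->
  evalv g (c *: x) = c ^+ e * evalv g x.
Proof.
move=> hg; rewrite /evalv !mevalE mulr_sumr big_seq [RHS]big_seq.
apply: eq_bigr => m /(dhomog_mf hg) /= <-; rewrite mulrCA; congr (_ * _).
rewrite mdegE -prodrXr -big_split /=; apply: eq_bigr => i _.
by rewrite mxE exprMn.
Qed.

Lemma evalv_linform x y : evalv (linform x) y = \sum_i x 0 i * y 0 i.
Proof.
rewrite /evalv raddf_sum; apply: eq_bigr => i _.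
by rewrite /= mevalZ mevalXU.
Qed.

End Evaluation.

Section LocalIdeal.
Variables (K : fieldType) (n : nat) (S : subscheme K n) (x : 'rV[K]_n).
Implicit Types (g b : {mpoly K[n]}) (u v : {fraction {mpoly K[n]}}).

Lemma tofrac_neq0 b : evalv b x != 0 -> tofrac b != 0.
Proof. by rewrite tofrac_eq0; apply: evalv_neq0. Qed.

Lemma local_ideal0 : local_ideal S x 0.
Proof.
exists 0%N, 0, 1; split; [exact: ideal0 | exact: dhomog0 | exact: dhomog1 | |].
  by rewrite /evalv meval1 oner_neq0.
by rewrite tofrac0 mul0r.
Qed.

Lemma local_idealD u v : local_ideal S x u -> local_ideal S x v ->
  local_ideal S x (u + v).
Proof.
move=> [e [a [b [Sa ha hb bx ->]]]] [e' [a' [b' [Sa' ha' hb' bx' ->]]]].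
exists (e + e')%N, (a * b' + a' * b), (b * b'); split.
- by apply: idealD; rewrite mulrC; apply: idealM.
- by apply: rpredD; [|rewrite addnC]; apply: dhomogM.
- exact: dhomogM.
- by rewrite evalvM mulf_neq0.
by rewrite addf_div ?tofrac_neq0 // tofracD !tofracM.
Qed.

Lemma local_idealMC c u : local_ideal S x u -> local_ideal S x (tofrac c%:MP * u).
Proof.
move=> [e [a [b [Sa ha hb bx ->]]]]; exists e, (c *: a), b; split=> //.
- by rewrite -mul_mpolyC; apply: idealM.
- exact: rpredZ.
by rewrite -mul_mpolyC tofracM mulrA.
Qed.

Lemma local_ideal_sum (I : Type) (r : seq I) (F : I -> {fraction {mpoly K[n]}}) :
  (forall i, local_ideal S x (F i)) -> local_ideal S x (\sum_(i <- r) F i).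
Proof.
by move=> SF; apply: big_ind => //; [exact: local_ideal0 | exact: local_idealD].
Qed.

(** If g/b = a'/b' with a' in the ideal of [S], then b' g = a' b is in it too, so the denominator b'
    is the required multiplier. *)
Lemma local_ideal_numer g b : evalv b x != 0 ->
  local_ideal S x (tofrac g / tofrac b) ->
  exists e c, [/\ c \is e.-homog, S (c * g) & evalv c x != 0].
Proof.
move=> bx [e [a' [b' [Sa' ha' hb' bx' /eqP]]]].
rewrite eqr_div ?tofrac_neq0 // -!tofracM tofrac_eq => /eqP eq_gb.
by exists e, b'; split=> //; rewrite mulrC eq_gb mulrC; apply: idealM.
Qed.

End LocalIdeal.

Section Scheme.
Variables (K : closedFieldType) (n : nat) (S : subscheme K n).
Implicit Types (g b ell : {mpoly K[n]}) (x : 'rV[K]_n).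

(** If [g] is not in the ideal, saturation keeps every power of the irrelevant ideal out of the
    colon ideal (S : g). The Nullstellensatz then gives a common zero of (S : g). It is a point of
    [S], because the ideal of [S] lies in (S : g), and no local multiplier [b] can exist there. *)
Lemma local_global g e : g \is e.-homog ->
  (forall x, point_of S x -> exists2 b, S (b * g) & evalv b x != 0) -> S g.
Proof.
move=> hg loc; apply: boolp.contrapT => nSg.
have hS := subscheme_homog_ideal S.
have [] := projective_nullstellensatz (colon_homog_ideal hS hg).
  by move=> k /ideal_saturated.
move=> x [x0 colonx]; have [|b Sbg] := loc x; last by rewrite colonx ?eqxx.
by split=> // h Sh; apply: colonx; apply: hidMr.
Qed.

(** The form is sought on the moment curve (1, t, t^2, ...): its value at [p i] is then a nonzero
    polynomial in [t], and a product of finitely many of these has a nonroot. *)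
Lemma exists_nonvanishing_linform m (p : 'I_m -> 'rV[K]_n) :
  (forall i, p i != 0) -> exists y, forall i, evalv (linform y) (p i) != 0.
Proof.
move=> p0; pose P i := \sum_(s < n) p i 0 s *: 'X^s : {poly K}.
have P0 : \prod_i P i != 0.
  apply/prodf_neq0 => i _; have /rV0Pn[s ps] := p0 i.
  apply: contraNneq ps => Pi0; have := congr1 (fun q : {poly K} => q`_s) Pi0.
  rewrite coef_sumMXn coef0 (big_pred1 s) // => ->.
  by [].
have /closed_nonrootP[t] := P0; rewrite /root horner_prod => /prodf_neq0 Pt.
exists (\row_s t ^+ s) => i; have := Pt i isT.
rewrite evalv_linform horner_sum; congr (_ != 0); apply: eq_bigr => s _.
by rewrite !hornerE mxE mulrC.
Qed.

Definition nonvanishing_on b := forall x, point_of S x -> evalv b x != 0.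

Lemma exists_nonvanishing_on m (p : 'I_m -> 'rV[K]_n) :
  enum_points S p -> exists y, nonvanishing_on (linform y).
Proof.
move=> [Sp _ pS]; have [|y yp] := exists_nonvanishing_linform (p := p).
  by move=> i; case: (Sp i).
exists y => x /pS[i [c c0 ->]].
by rewrite (evalv_scale _ _ (linform_dhomog y)) mulf_neq0 ?expf_neq0.
Qed.

(** At every point of [S], [b] itself serves as the multiplier in [local_global]. *)
Lemma nonvanishing_on_regular b g e : nonvanishing_on b -> g \is e.-homog ->
  S (b * g) -> S g.
Proof.
by move=> nb hg Sbg; apply: local_global hg _ => x Sx; exists b => //; apply: nb.
Qed.

(** Division by y^e, for a linear form [y] vanishing at no point of [S], maps forms of degree [e] to
    the product of the local rings of [S], which has dimension [N]. By [local_global], the kernel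
    consists of the forms in the ideal. *)
Lemma length_dependency N e k (g : 'I_k -> {mpoly K[n]}) : has_length S N ->
  (forall i, g i \is e.-homog) -> (N < k)%N ->
  exists2 c : 'I_k -> K, (exists i, c i != 0) & S (\sum_i c i *: g i).
Proof.
move=> [m [p [l [enum_p len ->]]]] hg lt_k.
have [y ny] := exists_nonvanishing_on enum_p.
pose q := linform y ^+ e.
have hq : q \is e.-homog by apply: linform_exp_dhomog.
have [Sp _ pS] := enum_p.
have qp i : evalv q (p i) != 0 by rewrite evalvX expf_neq0 // ny.
have /fin_all_exists2[u uP uE] (i : 'I_m) :
    exists2 u : 'I_(l i) -> {fraction {mpoly K[n]}}, True &
    exists A : 'I_k -> 'I_(l i) -> K, forall t, local_ideal S (p i)
      (tofrac (g t) / tofrac q - \sum_j tofrac (A t j)%:MP * u j).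
  have [u [_ span _]] := len i; exists u => //.
  have /fin_all_exists[A AE] (t : 'I_k) : exists A, local_ideal S (p i)
      (tofrac (g t) / tofrac q - \sum_j tofrac (A j)%:MP * u j).
    by apply: span; exists e, (g t), q; split.
  by exists A.
have {uE} /fin_all_exists[A AE] := uE.
(* The coordinates are indexed by pairs of a point and an element of the basis of its local ring,
   [N] pairs in all. *)
have [|c c0 rel] := @exists_dependency K {i : 'I_m & 'I_(l i)} k
    (fun t ij => A (tag ij) t (tagged ij)).
  rewrite card_tagged sumnE big_map big_enum /=.
  by rewrite (eq_bigr _ (fun i _ => card_ord (l i))).
exists c => //.
have hcg : \sum_i c i *: g i \is e.-homog.
  by apply: rpred_sum => i _; apply: rpredZ.
apply: local_global hcg _ => x Sx.
have [i [z z0 ->]] := pS x Sx.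
suff: local_ideal S (p i) (tofrac (\sum_i c i *: g i) / tofrac q).
  move=> /(local_ideal_numer (qp i))[e' [b [hb Sb bp]]].
  by exists b => //; rewrite (evalv_scale _ _ hb) mulf_neq0 ?expf_neq0.
have -> : tofrac (\sum_t c t *: g t) / tofrac q = \sum_t tofrac (c t)%:MP *
   (tofrac (g t) / tofrac q - \sum_j tofrac (A i t j)%:MP * u i j).
  under [RHS]eq_bigr do rewrite mulrBr mulrA -tofracM mul_mpolyC.
  rewrite sumrB -mulr_suml -raddf_sum /= [X in _ = _ - X](_ : _ = 0) ?subr0 //.
  under eq_bigr do rewrite mulr_sumr.
  rewrite exchange_big big1 // => j _.
  transitivity (tofrac (\sum_t c t * A i t j)%:MP * u i j).
    rewrite !raddf_sum mulr_suml; apply: eq_bigr => t _.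
    by rewrite mulrA -tofracM -mpolyCM.
  by have /= -> := rel (Tagged _ j); rewrite mpolyC0 tofrac0 mul0r.
by apply: local_ideal_sum => t; apply: local_idealMC.
Qed.

End Scheme.

(** * Apolarity *)

Section Differentiation.
Variables (K : fieldType) (n : nat).
Implicit Types (g h F : {mpoly K[n]}) (x : 'rV[K]_n) (m : 'X_{1..n}).

Lemma diffactD g h F : diffact (g + h) F = diffact g F + diffact h F.
Proof. by have := diffact_linear F 1 g h; rewrite !scale1r. Qed.

Lemma diffact0 F : diffact 0 F = 0.
Proof. by rewrite /diffact msupp0 big_nil. Qed.

Lemma diffactZ c g F : diffact (c *: g) F = c *: diffact g F.
Proof. by have := diffact_linear F c g 0; rewrite diffact0 !addr0. Qed.

Lemma diffact_sum (I : Type) (r : seq I) (G : I -> {mpoly K[n]}) F :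
  diffact (\sum_(i <- r) G i) F = \sum_(i <- r) diffact (G i) F.
Proof. exact: (big_morph _ (fun g h => diffactD g h F) (diffact0 F)). Qed.

Lemma diffactX m F : diffact 'X_[m] F = F^`M[m].
Proof. by rewrite /diffact msuppX big_seq1 mcoeffX eqxx scale1r. Qed.

Lemma diffactM g h F : diffact (g * h) F = diffact g (diffact h F).
Proof.
have XM m : diffact ('X_[m] * h) F = (diffact h F)^`M[m].
  rewrite {1}[h]mpolyE mulr_sumr diffact_sum /(diffact h) linear_sum.
  apply: eq_bigr => m' _; rewrite -scalerAr diffactZ -mpolyXD diffactX.
  by rewrite addmC mderivmDm /= mderivmZ.
rewrite {1}[g]mpolyE mulr_suml diffact_sum; apply: eq_bigr => m _.
by rewrite -scalerAl diffactZ XM.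
Qed.

Lemma pairingB F g h : pairing F (g - h) = pairing F g - pairing F h.
Proof. by rewrite /pairing diffactD -scaleN1r diffactZ scaleN1r mcoeffB. Qed.

Lemma pairingM F g h : pairing F (g * h) = pairing (diffact h F) g.
Proof. by rewrite /pairing diffactM. Qed.

Lemma mderiv_linform x i : (linform x)^`M(i) = (x 0 i)%:MP.
Proof.
rewrite /linform linear_sum /= (bigD1 i) //= big1 ?addr0 => [|j ne_ji].
  rewrite mderivZ mderivX mnm1E eqxx scale1r -{1}[U_(i)%MM]add0m addmK.
  by rewrite mpolyX0 -mul_mpolyC mulr1.
by rewrite mderivZ mderivX mnm1E (negPf ne_ji) scale0r scaler0.
Qed.

Lemma mderiv_linform_exp x i k :
  (linform x ^+ k.+1)^`M(i) = (k.+1%:R * x 0 i) *: linform x ^+ k.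
Proof.
elim: k => [|k IHk].
  by rewrite expr1 mul1r mderiv_linform expr0 -mul_mpolyC mulr1.
rewrite exprS mderivM IHk mderiv_linform mul_mpolyC -scalerAr -exprS -scalerDl.
by rewrite -[k.+2]add1n natrD mulrDl mul1r.
Qed.

Lemma mderivm_linform_exp x m :
  (linform x ^+ mdeg m)^`M[m] = ((mdeg m)`!%:R * evalv 'X_[m] x)%:MP.
Proof.
move: {2}(mdeg m) (erefl (mdeg m)) => k; elim: k m => [|k IHk] m dm.
  move/eqP: (dm); rewrite mdeg_eq0 => /eqP ->.
  by rewrite mdeg0 mderivm0m mpolyX0 /evalv meval1 mulr1.
have [|m1 [m2 [def_m /eqP/mdeg1P[i /eqP m1E]]]] := @mnm_split _ m 1.
  by rewrite dm.
have dm2 : mdeg m2 = k.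
  by move: dm; rewrite def_m m1E mdegD mdeg1 add1n => -[].
rewrite dm def_m m1E mderivmDm mderivmU1m mderiv_linform_exp linearZ /=.
have := IHk _ dm2; rewrite dm2 => ->.
rewrite factS mpolyXD evalvM natrM -mul_mpolyC -mpolyCM.
by rewrite /evalv mevalXU mulrACA.
Qed.

Lemma diffact_linform_exp g k x : g \is k.-homog ->
  diffact g (linform x ^+ k) = (k`!%:R * evalv g x)%:MP.
Proof.
move=> hg; rewrite /evalv {2}[g]mpolyE raddf_sum mulr_sumr raddf_sum /=.
rewrite /diffact big_seq [RHS]big_seq; apply: eq_bigr => m /(dhomog_mf hg) /= <-.
by rewrite mderivm_linform_exp mevalZ mulrCA [RHS]mpolyCM mul_mpolyC.
Qed.

Lemma pairing_linform_exp g k x : g \is k.-homog ->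
  pairing (linform x ^+ k) g = k`!%:R * evalv g x.
Proof.
by move=> hg; rewrite /pairing diffact_linform_exp // mcoeffC eqxx mulr1.
Qed.

End Differentiation.

Section PerfectPairing.
Variables (K : numFieldType) (n : nat).

(** Pairing with the monomial of exponent [m] gives m! times the coefficient of [F] at [m], and m!
    is nonzero in characteristic 0. *)
Lemma pairing_nondegenerate (F : {mpoly K[n]}) k : F \is k.-homog ->
  (forall g, g \is k.-homog -> pairing F g = 0) -> F = 0.
Proof.
move=> hF pF; apply/mpolyP => m; rewrite mcoeff0.
have [dm|ndm] := eqVneq (mdeg m) k; last exact: dhomog_nemf_coeff hF ndm.
have := pF 'X_[m]; rewrite dhomogX /= dm eqxx => /(_ isT).
rewrite /pairing diffactX mcoeff_mderivm addm0 => /eqP.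
rewrite mulrn_eq0 => /orP[|/eqP //]; rewrite -leqn0 leqNgt => /negP[].
by apply/prodn_gt0 => i; rewrite ffact_gt0.
Qed.

End PerfectPairing.

(** * The form g0 = A^-1(l^d) and the local ring of [S] at [l] *)

Section AntiPolarForm.
Variables (K : numClosedFieldType) (n d : nat) (f : dhomog n.+1 K (2 * d)).
Variables (S : subscheme K n.+1) (l : 'rV[K]_n.+1).
Hypotheses (nd_f : nondegenerate_catalecticant f).
Hypotheses (len_S : has_length S (catalecticant_rank f)).
Hypotheses (apolar_S : apolar S (val f)) (Sl : point_of S l).
Implicit Types (g h a b w : {mpoly K[n.+1]}).

Lemma catalecticant_rankE : catalecticant_rank f = \dim {:dhomog n.+1 K d}.
Proof.
apply: limg_dim_eq; suff -> : lker (catalecticant f) = 0%VS by rewrite capv0.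
by apply/eqP/lker0P/bij_inj.
Qed.

Lemma diffact_inj w : w \is d.-homog -> diffact w (val f) = 0 -> w = 0.
Proof.
move=> hw Aw; pose w' : dhomog n.+1 K d := DHomog hw.
suff /(congr1 val) : w' = 0 by [].
apply: (bij_inj nd_f); apply: val_inj.
by rewrite catalecticantE linear0.
Qed.

Lemma apolar_degree_d w : w \is d.-homog -> S w -> w = 0.
Proof. by move=> hw /apolar_S; apply: diffact_inj. Qed.

Lemma apolar_pairing g : S g -> pairing (val f) g = 0.
Proof. by move=> /apolar_S Sg; rewrite /pairing Sg mcoeff0. Qed.

(** With v_1, ..., v_N a basis of the forms of degree [d], the N + 1 forms a, b v_1, ..., b v_N are
    dependent modulo the ideal, as [S] has length [N]. Solving for [a] gives [w]. *)
Lemma apolar_division b e a : nonvanishing_on S b -> b \is e.-homog ->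
  a \is (d + e).-homog -> exists2 w, w \is d.-homog & S (a - b * w).
Proof.
move=> nb hb ha; pose N := \dim {:dhomog n.+1 K d}.
pose v (j : 'I_N) : dhomog n.+1 K d := (vbasis fullv)`_j.
pose g (i : 'I_N.+1) := oapp (fun j => b * val (v j)) a (unlift ord0 i).
have hv (c : 'I_N -> K) : val (\sum_j c j *: v j) = \sum_j c j *: val (v j).
  by rewrite raddf_sum.
have hg i : g i \is (d + e).-homog.
  rewrite /g; case: unliftP => [j _|_] //=; rewrite addnC.
  by apply: dhomogM => //; apply: dhomog_is_dhomog.
have [|c [i ci]] := length_dependency len_S hg.
  by rewrite catalecticant_rankE.
rewrite big_ord_recl /g unlift_none /=.
under eq_bigr do rewrite liftK /= scalerAr.
rewrite -mulr_sumr -hv; set w := val (\sum_j _) => Scw.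
have hw : w \is d.-homog by apply: dhomog_is_dhomog.
(* If the coefficient of [a] vanished, b w would be in the ideal, hence [w] too. The ideal has no
   nonzero form of degree [d], so the relation would be trivial. *)
have [c0|c0] := eqVneq (c ord0) 0.
  have w0 : w = 0.
    apply: (apolar_degree_d hw); apply: (nonvanishing_on_regular nb hw).
    by move: Scw; rewrite c0 scale0r add0r.
  have /freeP fr := basis_free (vbasisP {:dhomog n.+1 K d}).
  have v0 : \sum_j c (lift ord0 j) *: v j = 0.
    by apply: val_inj; rewrite raddf0.
  have cl0 := fr (fun j => c (lift ord0 j)) v0.
  case/negP: ci; case: (unliftP ord0 i) => [j ->|->]; first by rewrite cl0.
  by rewrite c0.
exists (- (c ord0)^-1 *: w); first exact: rpredZ.
have := idealM (c ord0)^-1%:MP Scw.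
rewrite mul_mpolyC scalerDr scalerA mulVf // scale1r.
by rewrite scaleNr mulrN opprK scalerAr.
Qed.

Let g0 := val ((catalecticant f)^-1%VF (linpow d l)).

Lemma antipole_homog : g0 \is d.-homog.
Proof. exact: dhomog_is_dhomog. Qed.

Lemma diffact_antipole : diffact g0 (val f) = linform l ^+ d.
Proof. by rewrite -catalecticantE catalecticantVK. Qed.

Lemma antipolarE : antipolar f l = d`!%:R * evalv g0 l.
Proof. exact: pairing_linform_exp antipole_homog. Qed.

Lemma pairing_antipole h : h \is d.-homog ->
  pairing (val f) (h * g0) = d`!%:R * evalv h l.
Proof. by move=> hh; rewrite pairingM diffact_antipole pairing_linform_exp. Qed.

Lemma exists_nonvanishing : exists y, nonvanishing_on S (linform y).
Proof.
have [m [p [k [enum_p _ _]]]] := len_S.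
exact: exists_nonvanishing_on enum_p.
Qed.

Lemma antipole_annihilates h : h \is d.-homog -> evalv h l = 0 -> S (g0 * h).
Proof.
move=> hh hl; have [y ny] := exists_nonvanishing.
pose q := linform y ^+ d.
have hq : q \is d.-homog by apply: linform_exp_dhomog.
have nq : nonvanishing_on S q by move=> x /ny; rewrite evalvX; apply: expf_neq0.
have hgh : g0 * h \is (d + d).-homog by apply: dhomogM antipole_homog hh.
have [w hw Sw] := apolar_division nq hq hgh.
suff w0 : w = 0 by move: Sw; rewrite w0 mulr0 subr0.
apply: (diffact_inj hw); apply: (@pairing_nondegenerate _ _ _ d).
  have := diffact_dhomog hw (dhomog_is_dhomog f).
  by rewrite (_ : (2 * d - d)%N = d) // mul2n -addnn addnK.
move=> k hk; rewrite -pairingM.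
have hhk : h * k \is (d + d).-homog by apply: dhomogM.
(* [pairing_antipole] needs a form of degree [d], so h k is replaced by h2 with h k = q h2 modulo
   the ideal. Then k w and h2 g0 agree modulo the ideal after multiplication by [q], hence already
   before it, and [f] pairs with both to d! h2(l) = 0. *)
have [h2 hh2 Sh2] := apolar_division nq hq hhk.
have h2l : evalv h2 l = 0.
  have [_ /(_ _ Sh2)/eqP] := Sl; rewrite evalvB !evalvM hl mul0r sub0r oppr_eq0.
  by rewrite mulf_eq0 (negPf (nq l Sl)) => /eqP.
have hkw : k * w - h2 * g0 \is (d + d).-homog.
  by apply: rpredB; apply: dhomogM => //; apply: antipole_homog.
have : S (k * w - h2 * g0).
  apply: (nonvanishing_on_regular nq hkw).
  have -> : q * (k * w - h2 * g0) =
      g0 * (h * k - q * h2) - k * (g0 * h - q * w) by ring.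
  by apply: (hidB (subscheme_homog_ideal S)); apply: idealM.
move=> /apolar_pairing/eqP; rewrite pairingB pairing_antipole // h2l mulr0.
by rewrite subr0 => /eqP.
Qed.

(** By contraposition: if g0(l) is nonzero, a nilpotent a/b has a(l) = 0, and a multiple of [a] by a
    form not vanishing at [l] is shown to be in the ideal, so a/b is zero in the local ring. *)
Lemma nonreduced_antipolar : nonreduced_at S l -> antipolar f l = 0.
Proof.
move=> [_ [N [[e [a [b [ha hb bl ->]]]] nSu SuN]]]; rewrite antipolarE.
apply/eqP; apply: contra_notT nSu; rewrite mulf_eq0 negb_or => /andP[_ g0l].
have al : evalv a l = 0.
  move: SuN; rewrite expr_div_n -!rmorphXn /= => /local_ideal_numer[].
    by rewrite evalvX expf_neq0.
  move=> e' [c [_ Sca cl]]; have [_ /(_ _ Sca)/eqP] := Sl.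
  by rewrite evalvM mulf_eq0 (negPf cl) evalvX expf_eq0 => /andP[_ /eqP].
have [y ny] := exists_nonvanishing.
have ne : nonvanishing_on S (linform y ^+ e).
  by move=> x /ny; rewrite evalvX; apply: expf_neq0.
(* Trading [a], of degree [e], for [w], of degree [d], makes [antipole_annihilates] applicable: w(l)
   = 0, so g0 w is in the ideal. *)
have [w hw Sw] : exists2 w, w \is d.-homog &
    S (linform y ^+ d * a - linform y ^+ e * w).
  apply: (apolar_division ne (linform_exp_dhomog e y)).
  exact: dhomogM (linform_exp_dhomog d y) ha.
have wl : evalv w l = 0.
  have [_ /(_ _ Sw)/eqP] := Sl; rewrite evalvB !evalvM al mulr0 sub0r oppr_eq0.
  by rewrite mulf_eq0 (negPf (ne l Sl)) => /eqP.
pose c := g0 * linform y ^+ d.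
have hc : c \is (d + d).-homog.
  exact: dhomogM antipole_homog (linform_exp_dhomog d y).
have cl : evalv c l != 0 by rewrite evalvM mulf_neq0 // evalvX expf_neq0 ?ny.
have Sca : S (c * a).
  have -> : c * a = g0 * (linform y ^+ d * a - linform y ^+ e * w) +
      linform y ^+ e * (g0 * w) by rewrite /c; ring.
  by apply: idealD; apply: idealM => //; apply: antipole_annihilates.
exists (d + d + e)%N, (c * a), (c * b); split=> //; try exact: dhomogM.
  by rewrite evalvM mulf_neq0.
by rewrite (tofracM c) (tofracM c) -mulf_div divff ?mul1r ?(tofrac_neq0 cl).
Qed.

(** The nilpotent is g0 / y^d: its square is zero by [antipole_annihilates] applied to h = g0. *)
Lemma antipolar_nonreduced : antipolar f l = 0 -> nonreduced_at S l.
Proof.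
rewrite antipolarE => /eqP; rewrite mulf_eq0 pnatr_eq0 -leqn0 leqNgt fact_gt0 /=.
move=> /eqP g0l; have [y ny] := exists_nonvanishing.
have nX k : nonvanishing_on S (linform y ^+ k).
  by move=> x /ny; rewrite evalvX; apply: expf_neq0.
have hX k := linform_exp_dhomog k y.
exists (tofrac g0 / tofrac (linform y ^+ d)), 2%N; split.
- by exists d, g0, (linform y ^+ d); split=> //; [exact: antipole_homog | exact: nX].
(* Were g0 / y^d zero, some b g0 with b(l) nonzero would be in the ideal. Replacing [b] by a form
   [w] of degree [d], still nonzero at [l], puts w g0 in the ideal, although [f] pairs with it to d!
   w(l). *)
- case/local_ideal_numer => [|e [b [hb Sb bl]]]; first exact: nX.
  have [w hw Sw] : exists2 w, w \is d.-homog &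
      S (linform y ^+ d * b - linform y ^+ e * w).
    by apply: (apolar_division (nX e) (hX e)); apply: dhomogM.
  have wl : evalv w l != 0.
    apply: contraNneq (mulf_neq0 (nX d l Sl) bl) => wl.
    have [_ /(_ _ Sw)] := Sl.
    by rewrite evalvB !evalvM wl mulr0 subr0 => ->.
  have hwg : w * g0 \is (d + d).-homog by apply: dhomogM antipole_homog.
  have Swg : S (w * g0).
    apply: (nonvanishing_on_regular (nX e) hwg).
    have -> : linform y ^+ e * (w * g0) = linform y ^+ d * (b * g0) -
        g0 * (linform y ^+ d * b - linform y ^+ e * w) by ring.
    by apply: (hidB (subscheme_homog_ideal S)); apply: idealM.
  have := apolar_pairing Swg; rewrite pairing_antipole // => /eqP.
  by rewrite mulf_eq0 (negPf wl) pnatr_eq0 -leqn0 leqNgt fact_gt0.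
rewrite expr_div_n -!rmorphXn /=.
exists (d * 2)%N, (g0 ^+ 2), ((linform y ^+ d) ^+ 2); split=> //.
- by rewrite expr2; apply: antipole_annihilates => //; apply: antipole_homog.
- exact: dhomogMn antipole_homog.
- exact: dhomogMn.
by rewrite evalvX expf_neq0 // (nX d l Sl).
Qed.

End AntiPolarForm.

Theorem proposition2p6 (R : realType) (n d : nat)
    (f : dhomog n.+1 R[i] (2 * d)) (S : subscheme R[i] n.+1)
    (l : 'rV[R[i]]_n.+1) :
  nondegenerate_catalecticant f ->
  zero_dimensional S ->
  has_length S (catalecticant_rank f) ->
  apolar S (val f) ->
  point_of S l ->
  (nonreduced_at S l <-> antipolar f l = 0).
Proof.
move=> nd_f _ len_S apolar_S Sl; split.
  exact: nonreduced_antipolar.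
exact: antipolar_nonreduced.
Qed.
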